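(* Let $b\ge2$, $d\ge1$, $t\ge0$ be integers, let $\mathcal S=(\boldsymbol x_n)_{n\ge0}$ be a $(t,d)$-sequence in base $b$, not necessarily digital, and let $\widetilde{\mathcal S}=(\widetilde{\boldsymbol x}_n)_{n\ge0}$ be obtained by applying a single full Owen scrambling to $\mathcal S$. For $n\ge1$, set $\widetilde P_n=(\widetilde{\boldsymbol x}_j)_{0\le j<n}$. Then, for every $\varepsilon>0$, there is a constant $c_{\varepsilon,b,d,t}>0$ depending only on $\varepsilon,b,d,t$ such that almost surely there exists $n_0$ with $$ \rho_\infty(\widetilde P_n)\ge c_{\varepsilon,b,d,t}\,n^{1/(2d)}(\log n)^{-1/2}\bigl(\log(2+\log n)\bigr)^{-(1+\varepsilon)/2} $$ for all $n\ge n_0$. In particular, the mesh ratio of the initial segments of $\widetilde{\mathcal S}$ diverges almost surely, and hence $\widetilde{\mathcal S}$ is almost surely not quasi-uniform.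
   Context: A $b$-adic elementary interval in $[0,1)^d$ is a set $\prod_{j=1}^d[a_jb^{-k_j},(a_j+1)b^{-k_j})$ with $k_j\in\mathbb N_0$, $0\le a_j<b^{k_j}$. For $0\le t\le m$, a $(t,m,d)$-net in base $b$ is a $b^m$-point multiset in $[0,1)^d$ such that every $b$-adic elementary interval of volume $b^{t-m}$ contains exactly $b^t$ of its points. A $(t,d)$-sequence in base $b$ is an infinite sequence $(\boldsymbol x_n)_{n\ge0}$ in $[0,1)^d$ such that for every $k\ge0$ and $m\ge t$ the point set $\{\boldsymbol x_n:kb^m\le n<(k+1)b^m\}$ is a $(t,m,d)$-net in base $b$. Full Owen scrambling in base $b$: independently for each coordinate $j$ and each finite digit prefix $a_1\cdots a_{r-1}\in\{0,\dots,b-1\}^{r-1}$ ($r\ge1$), choose a uniform random permutation $\pi_{j,a_1\cdots a_{r-1}}$ of $\{0,\dots,b-1\}$, all mutually independent. The $j$-th coordinate with base-$b$ digits $(a_r)_{r\ge1}$ (regular expansion, not ending in infinitely many digits $b-1$; for digital points, the specified output digits) is replaced by the number with digits $\widetilde a_r=\pi_{j,a_1\cdots a_{r-1}}(a_r)$. A single scrambling uses the same permutations for all points of the sequence. For an $N$-point multiset $P=(\boldsymbol x_n)_{0\le n<N}$ in $[0,1]^d$ with $N\ge2$: $h_\infty(P)=\sup_{\boldsymbol z\in[0,1]^d}\min_{n}\|\boldsymbol z-\boldsymbol x_n\|_\infty$, $q_\infty(P)=\frac12\min_{n<n'}\|\boldsymbol x_n-\boldsymbol x_{n'}\|_\infty$,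 and the mesh ratio is $\rho_\infty(P)=h_\infty(P)/q_\infty(P)$ ($=\infty$ if $q_\infty(P)=0$). A sequence is quasi-uniform if the supremum over $N\ge2$ of the mesh ratios of its first $N$ points is finite. *)

(* Defs.v *)
From HB Require Import structures.
From mathcomp Require Import all_boot all_order all_algebra all_fingroup.
From mathcomp Require Import all_classical all_reals all_analysis.

Set Implicit Arguments.
Unset Strict Implicit.
Unset Printing Implicit Defensive.

Import Order.TTheory GRing.Theory Num.Theory.
Import numFieldNormedType.Exports.

Local Open Scope classical_set_scope.
Local Open Scope ring_scope.

Section Nets.
Variables (R : realType) (b d : nat).

Definition in_half_open_cube (z : 'rV[R]_d) : Prop :=
  forall j, 0 <= z 0 j < 1.

Definition in_elementary_interval (k a : 'I_d -> nat) (z : 'rV[R]_d) : bool :=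
  [forall j, (a j)%:R / b%:R ^+ k j <= z 0 j < (a j).+1%:R / b%:R ^+ k j].

Definition elementary_volume (k : 'I_d -> nat) : R :=
  \prod_(j < d) b%:R ^- k j.

Definition is_net (t m : nat) (p : 'I_(b ^ m) -> 'rV[R]_d) : Prop :=
  (forall i, in_half_open_cube (p i)) /\
  forall k a : 'I_d -> nat,
    (forall j, (a j < b ^ k j)%N) ->
    elementary_volume k = b%:R ^+ t / b%:R ^+ m ->
    #|[set i | in_elementary_interval k a (p i)]%SET| = (b ^ t)%N.

Definition is_td_sequence (t : nat) (x : nat -> 'rV[R]_d) : Prop :=
  (forall n, in_half_open_cube (x n)) /\
  forall k m, (t <= m)%N ->
    is_net t (fun i : 'I_(b ^ m) => x (k * b ^ m + i)%N).

End Nets.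

Section Digits.
Variables (R : realType) (b d : nat).

(* Digits are indexed from 0, so that [a r] has weight b^-(r+1). *)
Definition digit_value (a : nat -> 'I_b) : R :=
  limn (series (fun r => (a r : nat)%:R / b%:R ^+ r.+1 : R)).

Definition regular_digits (a : nat -> 'I_b) : Prop :=
  forall r0, exists2 r, (r0 <= r)%N & (a r : nat) != b.-1.

(* The digital construction over an arbitrary commutative ring K with b
   elements: C j is the (infinite) generating matrix of coordinate j, psi s and
   eta j r are the input and output digit bijections, and
   (n %/ b ^ s) %% b is the s-th base-b digit of n.  The matrix-vector product
   is a finite sum because psi s maps 0 to 0 for all large s. *)
Definition digital_digits (a : nat -> 'I_d -> nat -> 'I_b) : Prop :=
  exists (K : finComNzRingType) (C : 'I_d -> nat -> nat -> K)
         (psi : nat -> nat -> K) (eta : 'I_d -> nat -> K -> 'I_b),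
    [/\ forall s, bijective (fun i : 'I_b => psi s i),
        exists s0, forall s, (s0 <= s)%N -> psi s 0%N = 0,
        forall j r, bijective (eta j r) &
        forall n j r, exists S0, forall S, (S0 <= S)%N ->
          a n j r =
            eta j r (\sum_(s < S) C j r s * psi s ((n %/ b ^ s) %% b)%N)].

(* [a n j] is the digit sequence of coordinate j of x n that is scrambled:
   the regular expansion or, for a digital sequence, its output digits, which
   may end in infinitely many digits b - 1. *)
Definition scrambling_digits
    (x : nat -> 'rV[R]_d) (a : nat -> 'I_d -> nat -> 'I_b) : Prop :=
  (forall n j, x n 0 j = digit_value (a n j)) /\
  ((forall n j, regular_digits (a n j)) \/ digital_digits a).

End Digits.

Section Scrambling.
Variables (R : realType) (b d : nat).
Variables (disp : measure_display) (Omega : measurableType disp).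
Variable P : probability Omega R.

(* [pi (j, u) w] is the permutation attached to coordinate j and to the digit
   prefix u, of any length. *)
Definition owen_permutations
    (pi : 'I_d * seq 'I_b -> Omega -> {perm 'I_b}) : Prop :=
  [/\ forall i (s : {perm 'I_b}), measurable (pi i @^-1` [set s]),
      forall i (s : {perm 'I_b}), P (pi i @^-1` [set s]) = ((b`!)%:R^-1)%:E &
      forall (I : seq ('I_d * seq 'I_b))
             (A : 'I_d * seq 'I_b -> set {perm 'I_b}),
        uniq I ->
        P (\bigcap_(i in [set` I]) (pi i @^-1` A i)) =
        (\prod_(i <- I) P (pi i @^-1` A i))%E].

Definition scramble_digits (p : seq 'I_b -> {perm 'I_b}) (a : nat -> 'I_b) :
    nat -> 'I_b :=
  fun r => p (mkseq a r) (a r).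

Definition owen_scramble (pi : 'I_d * seq 'I_b -> Omega -> {perm 'I_b})
    (a : nat -> 'I_d -> nat -> 'I_b) (w : Omega) : nat -> 'rV[R]_d :=
  fun n => \row_j digit_value R (scramble_digits (fun u => pi (j, u) w) (a n j)).

End Scrambling.

(* On 'rV[R]_d, `|z| is the maximum norm.  The infima below range over finite
   sets, nonempty when N >= 2, so they are minima. *)
Section MeshRatio.
Variables (R : realType) (d N : nat).
Implicit Type p : 'I_N -> 'rV[R]_d.

Definition fill_distance p : R :=
  sup [set inf [set `|z - p n| | n in [set: 'I_N]]
      | z in [set z : 'rV[R]_d | forall j, 0 <= z 0 j <= 1]].

Definition separation_radius p : R :=
  2^-1 * inf [set r | exists n n' : 'I_N, (n < n')%N /\ r = `|p n - p n'|].

Definition mesh_ratio p : \bar R :=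
  if separation_radius p == 0 then +oo%E
  else (fill_distance p / separation_radius p)%:E.

End MeshRatio.

Definition initial_segment (T : Type) (x : nat -> T) (N : nat) : 'I_N -> T :=
  fun i => x i.

Definition quasi_uniform (R : realType) (d : nat) (x : nat -> 'rV[R]_d) : Prop :=
  (ereal_sup [set mesh_ratio (@initial_segment _ x N) | N in [set N | (2 <= N)%N]]
   < +oo)%E.

Arguments initial_segment {T} x N.

(* Main.v *)
Require Import Defs.
From HB Require Import structures.
From mathcomp Require Import all_boot all_order all_algebra all_fingroup.
From mathcomp Require Import all_classical all_reals all_analysis measurable_realfun.
From mathcomp Require Import zify ring lra.

Import Order.TTheory GRing.Theory Num.Theory.
Import numFieldNormedType.Exports.

Local Open Scope classical_set_scope.
Local Open Scope ring_scope.

Set Implicit Arguments.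
Unset Strict Implicit.
Unset Printing Implicit Defensive.

(** The fill distance of [n] points is at least of order [n ^ -(1/d)], because
fewer than [M ^ d] points cannot come near all the centres of a grid with
[M ^ d] cells ([fill_distance_ge]).  So the mesh ratio is large as soon as two of
the points are much closer than that, and the scrambling produces such pairs by
chance.

Divide the cube into [b ^ (K * d)] cubes [u] of side [b ^ -K].  The net property
gives, among the first [b ^ ((K + 2) * d + t)] points, two points of [u] whose
next digit is [0], respectively [1], in every coordinate
([td_sequence_prefix]).  If the permutation attached to the prefix of [u] fixes
[0] and [1], and if the next [l] scrambled digits of these points are all
[b - 1], respectively all [0], in every coordinate, then the two scrambled points
lie on either side of a common corner, at distance at most
[2 * b ^ -(K + 1 + l)] ([scramble_pair_dist]).  This event has a probability of
the form [p ^ d], with [p] of order [b ^ (-2 * l)], so that the expected number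
of such pairs is [lam ^ d] with [lam = b ^ K * p] of order [b ^ (K - 2 * l)].

For two cubes the events are not independent when the cubes agree in some
coordinate.  But in a coordinate where they agree the conditions of the second
cube can simply be dropped, and where they differ they involve other
permutations.  The second moment is therefore at most [(lam + lam ^ 2) ^ d]
([pair_event_joint]), and the second moment method ([second_moment]) bounds the
probability that no pair is close by [(1 + lam^-1) ^ d - 1], which is of order
[lam^-1] ([no_pair_prob]).

Taking [l] as large as possible with [lam] at least of order
[g K = K * (ln K) ^ (1 + eps)] makes these probabilities summable
([gauge_summable]), and by the Borel-Cantelli lemma almost surely every large
scale [K] has a close pair.  Then the mesh ratio of every initial segment with
about [b ^ (K * d)] points is at least of order [b ^ l], that is of order
[(b ^ K / g K) ^ (1/2)]; in terms of the number [n] of points this is the stated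
rate ([rate_le_tail]).  The rate is unbounded, whence the divergence and the
failure of quasi-uniformity. *)

(** * Digit expansions and elementary intervals *)

Definition prefix_num (b : nat) (s : seq 'I_b) : nat :=
  foldl (fun n (c : 'I_b) => n * b + c)%N 0%N s.

Lemma prefix_num_rcons (b : nat) (s : seq 'I_b) (c : 'I_b) :
  prefix_num (rcons s c) = (prefix_num s * b + c)%N.
Proof. by rewrite /prefix_num foldl_rcons. Qed.

Lemma prefix_num_lt (b : nat) (s : seq 'I_b) :
  (prefix_num s < b ^ size s)%N.
Proof.
elim/last_ind: s => [|s c IH]; first by rewrite expn0.
rewrite prefix_num_rcons size_rcons expnS mulnC.
have := ltn_ord c; nia.
Qed.

Lemma prefix_num_inj (b : nat) (s s' : seq 'I_b) :
  size s = size s' -> prefix_num s = prefix_num s' -> s = s'.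
Proof.
elim/last_ind: s s' => [|s c IH] s'; first by case: s'.
case/lastP: s' => [|s' c']; first by rewrite size_rcons.
rewrite !size_rcons !prefix_num_rcons => -[hsize] hnum.
have b0 : (0 < b)%N by apply: leq_ltn_trans (ltn_ord c).
have hc : c = c' :> nat.
  by have := congr1 (modn^~ b) hnum; rewrite !modnMDl !modn_small.
have hs : prefix_num s = prefix_num s'.
  have := congr1 (divn^~ b) hnum.
  by rewrite !divnMDl // !divn_small // !addn0.
by rewrite (IH _ hsize hs) (val_inj hc).
Qed.

Lemma series_digitsE (R : realType) (b : nat) (a : nat -> 'I_b) (n : nat) :
  series (fun r => (a r : nat)%:R / b%:R ^+ r.+1 : R) n =
  (prefix_num (mkseq a n))%:R / b%:R ^+ n.
Proof.
have b0 : (b%:R : R) != 0.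
  by rewrite pnatr_eq0 -lt0n; apply: leq_ltn_trans (ltn_ord (a 0%N)).
rewrite /series /=; elim: n => [|n IH]; first by rewrite big_geq ?mul0r.
rewrite big_nat_recr //= IH mkseqS prefix_num_rcons natrD natrM exprS.
by field; rewrite b0 expf_neq0.
Qed.

(** Truncating after [n] digits changes the value by at most one unit of the
last digit kept; both ends can be attained, since the tail may consist of
digits [b - 1]. *)
Lemma digit_value_bounds (R : realType) (b : nat) (a : nat -> 'I_b) (n : nat) :
  (prefix_num (mkseq a n))%:R / b%:R ^+ n <= digit_value R a /\
  digit_value R a <= (prefix_num (mkseq a n)).+1%:R / b%:R ^+ n.
Proof.
have b0 : (0 < (b%:R : R)).
  by rewrite ltr0n; apply: leq_ltn_trans (ltn_ord (a 0%N)).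
pose S m : R := (prefix_num (mkseq a m))%:R / b%:R ^+ m.
pose T m : R := (prefix_num (mkseq a m)).+1%:R / b%:R ^+ m.
have hS : series (fun r => (a r : nat)%:R / b%:R ^+ r.+1 : R) = S.
  by apply/funext => m; exact: series_digitsE.
have Sup : {homo S : i j / (i <= j)%N >-> i <= j}.
  apply/nondecreasing_seqP => m.
  rewrite /S mkseqS prefix_num_rcons exprS invfM mulrA.
  rewrite ler_pM2r ?invr_gt0 ?exprn_gt0 // ler_pdivlMr //.
  by rewrite -natrM ler_nat leq_addr.
have Tdown : {homo T : i j / (i <= j)%N >-> j <= i}.
  apply/nonincreasing_seqP => m.
  rewrite /T mkseqS prefix_num_rcons exprS invfM mulrA.
  rewrite ler_pM2r ?invr_gt0 ?exprn_gt0 // ler_pdivrMr //.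
  rewrite -natrM ler_nat; have := ltn_ord (a m); nia.
have ST m : S m <= T m.
  by rewrite /S /T ler_pM2r ?invr_gt0 ?exprn_gt0 // ler_nat.
have ST' i j : S i <= T j.
  by case: (leqP i j) => ij; [apply: le_trans (Sup _ _ ij) (ST j) |
     apply: le_trans (ST i) (Tdown _ _ (ltnW ij))].
have cS : cvgn S.
  by apply: nondecreasing_is_cvgn => //; exists (T 0%N) => _ [i _ <-].
rewrite /digit_value hS; split; first exact: nondecreasing_cvgn_le.
by apply: limr_le => //; near=> m; exact: ST'.
Unshelve. all: by end_near. Qed.

(** The value does not determine the digits, because of the expansions that end
in digits [b - 1].  But a value whose next digit would be [1] is not on the
boundary of the elementary interval of [s], and then every expansion of it
begins with [s]. *)
Lemma digit_prefix_of_value (R : realType) (b : nat) (hb : (2 <= b)%N)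
    (a : nat -> 'I_b) (s : seq 'I_b) :
  (prefix_num s * b + 1)%:R / b%:R ^+ (size s).+1 <= digit_value R a
    < (prefix_num s * b + 1).+1%:R / b%:R ^+ (size s).+1 ->
  mkseq a (size s) = s.
Proof.
move=> /andP[lo hi].
have b0 : 0 < (b%:R : R) by rewrite ltr0n; lia.
have bn0 : 0 < (b%:R : R) ^+ size s by rewrite exprn_gt0.
have [L U] := digit_value_bounds R a (size s).
apply: prefix_num_inj; first by rewrite size_mkseq.
set p := prefix_num s in lo hi *; set B := prefix_num _ in L U *.
move: (le_lt_trans L hi) (le_trans lo U).
rewrite exprS !ler_pdivrMr ?mulr_gt0 // !ltr_pdivrMr //.
rewrite [_ / (_ * _) * _](_ : _ = (p * b + 1).+1%:R / b%:R); last first.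
  by field; rewrite !gt_eqF.
rewrite [_ / _ * _](_ : _ = B.+1%:R * b%:R); last first.
  by field; rewrite !gt_eqF.
rewrite ltr_pdivlMr // -!natrM ltr_nat ler_nat; nia.
Qed.

(** The net property at scale [b ^- (D + 1)] supplies a point with prescribed
first [D] digits in every coordinate: prescribing [1] as the next digit keeps
the value inside the elementary interval. *)
Lemma td_sequence_prefix (R : realType) (b d t : nat) (hb : (2 <= b)%N)
    (x : nat -> 'rV[R]_d) (a : nat -> 'I_d -> nat -> 'I_b) (D : nat)
    (s : 'I_d -> seq 'I_b) :
  is_td_sequence b t x ->
  (forall n j, x n 0 j = digit_value R (a n j)) ->
  (forall j, size (s j) = D) ->
  exists2 n, (n < b ^ (D.+1 * d + t))%N & forall j, mkseq (a n j) D = s j.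
Proof.
move=> [_ /(_ 0%N (D.+1 * d + t)%N (leq_addl _ _)) [_ net]] xa hs.
have b0 : (b%:R : R) != 0 by rewrite pnatr_eq0; lia.
pose k (j : 'I_d) := D.+1; pose p j := (prefix_num (s j) * b + 1)%N.
have hp j : (p j < b ^ k j)%N.
  by have := prefix_num_lt (s j); rewrite /p /k hs expnS; nia.
have vol : elementary_volume R b k = b%:R ^+ t / b%:R ^+ (D.+1 * d + t).
  rewrite /elementary_volume /k prodr_const card_ord -exprVn -exprM exprD invfM.
  by rewrite exprVn mulrCA divff ?mulr1 // expf_neq0.
have := net k p hp vol; set E := [set i | _]%SET => cardE.
have /card_gt0P[i] : (0 < #|E|)%N by rewrite cardE expn_gt0; lia.
rewrite inE => /forallP hi; exists i => // j.
have := hi j; rewrite mul0n add0n xa /k /p => hv.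
have := @digit_prefix_of_value R b hb (a i j) (s j); rewrite hs; exact.
Qed.

(** Consecutive prefixes belong to adjacent intervals, and the two values lie in
their closures. *)
Lemma adjacent_prefix_dist (R : realType) (b : nat) (al be : nat -> 'I_b)
    (n : nat) :
  prefix_num (mkseq be n) = (prefix_num (mkseq al n)).+1 ->
  `|digit_value R al - digit_value R be| <= 2 / b%:R ^+ n.
Proof.
move=> h; have [La Ua] := digit_value_bounds R al n.
have [Lb Ub] := digit_value_bounds R be n; rewrite h in Lb Ub.
set B := prefix_num _ in La Ua Lb Ub.
rewrite distrC ger0_norm; last by rewrite subr_ge0; exact: le_trans Ua Lb.
have hB : B.+2%:R = B%:R + 2 :> R by rewrite -addn2 natrD.
move: Ub; rewrite hB => Ub.
have : digit_value R be - digit_value R al <=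
    (B%:R + 2) / b%:R ^+ n - B%:R / b%:R ^+ n by exact: lerB.
by rewrite mulrDl addrAC subrr add0r.
Qed.

(** Adding one to [s 0 (b-1) ... (b-1)] propagates a carry and gives
[s 1 0 ... 0]. *)
Lemma carry_prefix_num (b : nat) (al be : nat -> 'I_b) (K l : nat) :
  (forall r, (r < K)%N -> al r = be r) ->
  al K = 0%N :> nat -> be K = 1%N :> nat ->
  (forall r, (r < l)%N -> al (K.+1 + r)%N = b.-1 :> nat) ->
  (forall r, (r < l)%N -> be (K.+1 + r)%N = 0%N :> nat) ->
  prefix_num (mkseq be (K.+1 + l)) = (prefix_num (mkseq al (K.+1 + l))).+1.
Proof.
move=> eqK alK beK; elim: l => [|l IH] al_tail be_tail.
  rewrite addn0 !mkseqS !prefix_num_rcons alK beK addn0 addn1.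
  congr (prefix_num _ * _).+1; apply/eq_in_map => r.
  by rewrite mem_iota => /andP[_ rK]; rewrite eqK.
rewrite addnS (mkseqS al) (mkseqS be) !prefix_num_rcons IH => [|r rl|r rl].
- rewrite al_tail // be_tail //; have := ltn_ord (al 0%N); nia.
- by apply: al_tail; rewrite ltnS ltnW.
- by apply: be_tail; rewrite ltnS ltnW.
Qed.

(** * Bounds on the mesh ratio *)

Section MeshRatioBounds.
Variables (R : realType) (d : nat).

Lemma row_norm_le (v : 'rV[R]_d) (r : R) :
  0 <= r -> (forall j, `|v 0 j| <= r) -> `|v| <= r.
Proof.
move=> r0 vr; rewrite [leLHS]mx_normrE; apply: bigmax_le => // -[i j] _ /=.
by rewrite ord1.
Qed.

Lemma coord_le_row_norm (v : 'rV[R]_d) (j : 'I_d) : `|v 0 j| <= `|v|.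
Proof.
by rewrite [leRHS]mx_normrE (le_bigmax 0 (fun ij => `|v ij.1 ij.2|) (0, j)).
Qed.

(** The cells of an [M ^ d] grid have centres at mutual distance at least
[M^-1], so that a point is within [(2 * M)^-1] of at most one of them: fewer
than [M ^ d] points leave a centre uncovered. *)
Lemma fill_distance_ge (N M : nat) (p : 'I_N -> 'rV[R]_d) :
  (0 < N)%N -> (N < M ^ d)%N -> (2 * M%:R)^-1 <= fill_distance p.
Proof.
move=> N0 NM; set h : R := (2 * M%:R)^-1.
pose i0 : 'I_N := Ordinal N0.
have h0 : 0 <= h by rewrite invr_ge0 mulr_ge0.
pose z (c : {ffun 'I_d -> 'I_M}) : 'rV[R]_d :=
  \row_j ((2 * (c j : nat)%:R + 1) * h).
have Mh : M%:R * h = 2^-1.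
  have M0 : (M%:R : R) != 0.
    rewrite pnatr_eq0; apply: contraTneq NM => ->.
    by rewrite -leqNgt; apply: leq_trans (N0); case: (d) => // k; rewrite exp0n.
  by rewrite /h invfM mulrCA divff ?mulr1.
have z01 c : forall j, 0 <= z c 0 j <= 1.
  move=> j; rewrite mxE; apply/andP; split.
    by rewrite mulr_ge0 // addr_ge0 ?mulr_ge0.
  have : 2 * (c j)%:R + 1 <= 2 * M%:R - 1 :> R.
    have : (c j).+1%:R <= M%:R :> R by rewrite ler_nat.
    by rewrite -natr1; lra.
  move=> /(ler_wpM2r h0) /le_trans; apply.
  by rewrite mulrBl mul1r -mulrA Mh; lra.
have [c hc] : exists c, forall n, h <= `|z c - p n|.
  apply: contrapT => /forallNP cov.
  have {}cov c : exists n, `|z c - p n| < h.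
    have /existsNP[n /negP] := cov c.
    by rewrite -ltNge => hn; exists n.
  have [f hf] := choice cov.
  have inj_f : injective f.
    move=> c c' ff'; apply/ffunP => j; apply/val_inj/eqP.
    have := le_lt_trans (coord_le_row_norm _ j) (hf c).
    have := le_lt_trans (coord_le_row_norm _ j) (hf c').
    rewrite -ff' !mxE -/h; set q := p _ _ _ => h1 h2.
    have : `|(2 * (c j)%:R + 1) * h - (2 * (c' j)%:R + 1) * h| < 2 * h.
      have := ler_normB ((2 * (c j)%:R + 1) * h - q) ((2 * (c' j)%:R + 1) * h - q).
      by rewrite opprB addrA subrK; lra.
    rewrite -mulrBl normrM (ger0_norm h0).
    have hp : 0 < h by rewrite (le_lt_trans _ h1).
    rewrite ltr_pM2r // => lt2.
    apply/negPn/negP => neq.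
    have : 1 <= `|(c j)%:R - (c' j)%:R| :> R.
      move: neq; rewrite neq_ltn => /orP[] cc; last first.
        by rewrite ler_normr lerBrDr nat1r ler_nat cc.
      by rewrite distrC ler_normr lerBrDr nat1r ler_nat cc.
    move: lt2; have -> : 2 * (c j)%:R + 1 - (2 * (c' j)%:R + 1) =
              2 * ((c j)%:R - (c' j)%:R) :> R by ring.
    by rewrite normrM ger0_norm // -[ltRHS]mulr1 ltr_pM2l // ltNge => /negP.
  have := leq_card f inj_f.
  by rewrite card_ffun !card_ord leqNgt NM.
apply: (@le_trans _ _ (inf [set `|z c - p n| | n in [set: 'I_N]])).
  apply: lb_le_inf; first by exists `|z c - p i0|, i0.
  by move=> _ [n _ <-].
apply: ub_le_sup; last by exists (z c).
exists (1 + `|p i0|) => _ [y y01 <-].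
apply: (@le_trans _ _ `|y - p i0|).
  by apply: ge_inf; [exists 0 => _ [n _ <-] | exists i0].
apply: le_trans (ler_normB _ _) _; rewrite lerD2r.
by apply: row_norm_le => // j; have /andP[y0 y1] := y01 j; rewrite ger0_norm.
Qed.

Lemma separation_radius_ge0 (N : nat) (p : 'I_N -> 'rV[R]_d) :
  0 <= separation_radius p.
Proof.
rewrite /separation_radius mulr_ge0 ?invr_ge0 //; set S := [set _ | _].
have [->|S0] := eqVneq S set0; first by rewrite inf0.
apply: lb_le_inf; first exact/set0P.
by move=> _ [n [n' [_ ->]]].
Qed.

Lemma separation_radius_le (N : nat) (p : 'I_N -> 'rV[R]_d) (n n' : 'I_N) :
  n != n' -> separation_radius p <= 2^-1 * `|p n - p n'|.
Proof.
move=> nn'; rewrite ler_wpM2l ?invr_ge0 //; apply: ge_inf.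
  by exists 0 => _ [k [k' [_ ->]]].
case: (ltngtP n n') => [lt|gt|eq]; first by exists n, n'.
- by exists n', n; rewrite distrC.
- by rewrite (val_inj eq) eqxx in nn'.
Qed.

Lemma mesh_ratio_ge (N : nat) (p : 'I_N -> 'rV[R]_d) (h q : R) :
  0 <= h -> 0 < q -> h <= fill_distance p -> separation_radius p <= q ->
  ((h / q)%:E <= mesh_ratio p)%E.
Proof.
move=> h0 q0 hp pq; rewrite /mesh_ratio; case: eqP => [_|/eqP s0].
  by rewrite leey.
have sp : 0 < separation_radius p by rewrite lt0r s0 separation_radius_ge0.
rewrite lee_fin; apply: ler_pM => //; first by rewrite invr_ge0 ltW.
by rewrite lef_pV2 ?posrE.
Qed.

End MeshRatioBounds.

(** * Second moments and the law of one permutation *)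

Section SecondMoment.
Variables (R : realType) (disp : measure_display) (Omega : measurableType disp).
Variable P : probability Omega R.

(** Integrating an inequality between nonnegative simple functions. *)
Lemma indicator_sum_le (I J : finType) (c : I -> R) (e : J -> R)
    (A : I -> set Omega) (B : J -> set Omega) :
  (forall i, 0 <= c i) -> (forall j, 0 <= e j) ->
  (forall i, measurable (A i)) -> (forall j, measurable (B j)) ->
  (forall w, \sum_i c i * \1_(A i) w <= \sum_j e j * \1_(B j) w) ->
  \sum_i c i * fine (P (A i)) <= \sum_j e j * fine (P (B j)).
Proof.
have int_sum (T : finType) (k : T -> R) (D : T -> set Omega) :
    (forall i, 0 <= k i) -> (forall i, measurable (D i)) ->
    measurable_fun [set: Omega]
      (fun w => (\sum_i k i * \1_(D i) w)%:E : \bar R) /\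
    (\int[P]_w (\sum_i k i * \1_(D i) w)%:E =
     (\sum_i k i * fine (P (D i)))%:E)%E.
  move=> k0 mD.
  have mE i : measurable_fun [set: Omega] (fun w => (k i * \1_(D i) w)%:E : \bar R).
    apply/measurable_EFinP; apply: measurable_funM; first exact: measurable_cst.
    exact: measurable_indic.
  have sumE w : (\sum_i k i * \1_(D i) w)%:E = (\sum_i (k i * \1_(D i) w)%:E)%E.
    by rewrite sumEFin.
  split; first by under eq_fun do rewrite sumE; apply: emeasurable_sum.
  under eq_integral do rewrite sumE.
  rewrite ge0_integral_sum //; last first.
    by move=> i w _; rewrite lee_fin mulr_ge0.
  rewrite -sumEFin; apply: eq_bigr => i _.
  under eq_integral do rewrite EFinM.
  have mi : measurable_fun [set: Omega] (fun w => (\1_(D i) w)%:E : \bar R).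
    by apply/measurable_EFinP; exact: measurable_indic.
  rewrite (ge0_integralZl_EFin P measurableT _ mi) //.
  by rewrite integral_indic // setIT EFinM fineK // fin_num_measure.
move=> c0 e0 mA mB le.
have [mc ic] := int_sum _ c A c0 mA; have [me ie] := int_sum _ e B e0 mB.
rewrite -lee_fin -ic -ie; apply: ge0_le_integral => //.
- by move=> w _; rewrite lee_fin; apply: sumr_ge0 => i _; rewrite mulr_ge0.
- by move=> w _; rewrite lee_fin le.
Qed.

(** Second moment method.  Let [N] be the number of events [E u] that occur
and [m] its mean.  On [F], where [N] vanishes, [m ^ 2 = (N - m) ^ 2]; hence
[m ^ 2 * 1_F + 2 * m * N <= N ^ 2 + m ^ 2] everywhere, and it remains to take
means. *)
Lemma second_moment (U : finType) (E : U -> set Omega) (F : set Omega)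
    (p : R) (q : U -> U -> R) :
  (forall u, measurable (E u)) -> measurable F ->
  (forall u w, F w -> ~ E u w) ->
  (forall u, P (E u) = p%:E) ->
  (forall u v, fine (P (E u `&` E v)) <= q u v) ->
  (#|U|%:R * p) ^+ 2 * fine (P F) + (#|U|%:R * p) ^+ 2 <= \sum_u \sum_v q u v.
Proof.
move=> mE mF FE PE Pq; set m := _ * p.
have m0 : 0 <= m.
  rewrite /m; have [->|/card_gt0P[u _]] := posnP #|U|; first by rewrite mul0r.
  by rewrite mulr_ge0 // -lee_fin -(PE u).
pose c (i : unit + U) : R := if i is inl _ then m ^+ 2 else 2 * m.
pose A (i : unit + U) := if i is inr u then E u else F.
pose e (i : unit + U * U) : R := if i is inl _ then m ^+ 2 else 1.
pose B (i : unit + U * U) := if i is inr uv then E uv.1 `&` E uv.2 else setT.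
have pe w : \sum_i c i * \1_(A i) w <= \sum_j e j * \1_(B j) w.
  rewrite !big_sumType /= !big_const !card_unit /= !addr0.
  rewrite -mulr_sumr indicT mulr1.
  set N := \sum_(u : U) _.
  have -> : \sum_(i : U * U) 1 * \1_(E i.1 `&` E i.2) w = N ^+ 2.
    rewrite -(pair_bigA _ (fun u v => 1 * \1_(E u `&` E v) w)) /= expr2 mulr_suml.
    apply: eq_bigr => u _; rewrite mulr_sumr; apply: eq_bigr => v _.
    by rewrite indicI mul1r.
  rewrite [\1_F w]indicE; have [Fw|nFw] := pselect (F w).
    rewrite mem_set // /N big1 => [|u _]; last first.
      by rewrite indicE memNset //; exact: FE.
    by rewrite mulr0 addr0 mulr1 expr0n /= addr0.
  rewrite memNset // mulr0 add0r; have := sqr_ge0 (N - m); nra.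
have mA i : measurable (A i) by rewrite /A; case: i.
have mB j : measurable (B j).
  by rewrite /B; case: j => [a|[u v]] /=; [exact: measurableT | exact: measurableI].
have c0 i : 0 <= c i by case: i => [a|u]; [exact: sqr_ge0 | exact: mulr_ge0].
have e0 j : 0 <= e j by case: j => [a|uv]; [exact: sqr_ge0 | exact: ler01].
have := indicator_sum_le c0 e0 mA mB pe.
rewrite /c /A /e /B !big_sumType /= !big_const !card_unit /= !addr0.
rewrite probability_setT mulr1.
have sumE : \sum_u fine (P (E u)) = m.
  by under eq_bigr do rewrite PE; rewrite sumr_const -mulr_natl.
rewrite -mulr_sumr sumE.
rewrite -(pair_bigA _ (fun u v => 1 * fine (P (E u `&` E v)))) /=.
have : \sum_u \sum_v 1 * fine (P (E u `&` E v)) <= \sum_u \sum_v q u v.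
  by apply: ler_sum => u _; apply: ler_sum => v _; rewrite mul1r.
rewrite expr2; nra.
Qed.

End SecondMoment.

Section PermutationLaw.
Variables (R : realType) (b d : nat) (disp : measure_display).
Variables (Omega : measurableType disp) (P : probability Omega R).
Variable pi : 'I_d * seq 'I_b -> Omega -> {perm 'I_b}.
Hypothesis Ppi : owen_permutations P pi.

Lemma preimage_perm_set i (A : {set {perm 'I_b}}) :
  measurable (pi i @^-1` [set` A]) /\
  P (pi i @^-1` [set` A]) = (#|A|%:R / b`!%:R)%:E.
Proof.
have [mpi Ppi1 _] := Ppi.
elim: {A}#|A| {-2}A (eqxx #|A|) => [|n IH] A.
  rewrite cards_eq0 => /eqP ->.
  have -> : pi i @^-1` [set` (finset.set0 : {set {perm 'I_b}})] = set0.
    by apply/seteqP; split => w //=; rewrite inE.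
  by rewrite cards0 mul0r measure0; split.
move=> /eqP cA; have /card_gt0P[s sA] : (0 < #|A|)%N by rewrite cA.
have cB : #|(A :\ s)%SET| == n by have := cardsD1 s A; rewrite sA cA; lia.
have [mB PB] := IH _ cB.
have -> : pi i @^-1` [set` A] =
    pi i @^-1` [set s] `|` pi i @^-1` [set` (A :\ s)%SET].
  apply/seteqP; split => w /=; rewrite !inE.
    by move=> wA; case: (eqVneq (pi i w) s) => [->|_]; [left|right].
  by case=> [->|/andP[]].
split; first exact: measurableU.
have dis : pi i @^-1` [set s] `&` pi i @^-1` [set` (A :\ s)%SET] = set0.
  by apply/seteqP; split => w //= -[->]; rewrite !inE eqxx.
apply: etrans (measureU P (mpi i s) mB dis) _.
apply: etrans (congr2 adde (Ppi1 i s) PB) _.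
rewrite (eqP cB) cA; apply: etrans (esym (EFinD _ _)) _; apply: congr1.
by rewrite -natr1 mulrDl mul1r addrC.
Qed.

(** By symmetry in the value taken, a uniform permutation sends a given letter
to a given letter with probability [b^-1]. *)
Lemma card_perm_letter (a c : 'I_b) :
  (#|[set s : {perm 'I_b} | s a == c]%SET|%:R / b`!%:R : R) = b%:R^-1.
Proof.
pose N e := #|[set s : {perm 'I_b} | s a == e]%SET|.
have Nc e : N e = N c.
  rewrite /N -(card_imset _ (mulIg (tperm e c))).
  apply: eq_card => s; rewrite !inE; apply/imsetP/eqP => [[r]|sa].
    by rewrite inE => /eqP re ->; rewrite permM re tpermL.
  exists (s * tperm e c)%g; last by rewrite -mulgA tperm2 mulg1.
  by rewrite inE permM sa tpermR.
have tot : (b * N c = b`!)%N.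
  rewrite -[b in LHS](card_ord b) -sum_nat_const.
  rewrite (eq_bigr N); last by move=> e _; rewrite Nc.
  rewrite -card_Sn -[RHS]sum1_card.
  rewrite (partition_big (fun s : {perm 'I_b} => s a) xpredT) //=.
  by apply: eq_bigr => e _; rewrite /N -sum1_card; apply: eq_bigl => s; rewrite !inE.
have b0 : (b`!%:R : R) != 0 by rewrite pnatr_eq0 -lt0n fact_gt0.
have b1 : (b%:R : R) != 0.
  by rewrite pnatr_eq0; rewrite -lt0n (leq_ltn_trans (leq0n _) (ltn_ord a)).
apply: (mulIf b0); rewrite divfK // -tot natrM mulrA mulVf ?mul1r //.
Qed.

End PermutationLaw.

(** * Counting the close pairs *)

Section PairEvents.
Variables (R : realType) (b d : nat) (disp : measure_display).
Variables (Omega : measurableType disp) (P : probability Omega R).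
Variable pi : 'I_d * seq 'I_b -> Omega -> {perm 'I_b}.
Hypothesis Ppi : owen_permutations P pi.

Definition cylinder (L : seq ('I_d * seq 'I_b))
    (A : 'I_d * seq 'I_b -> {set {perm 'I_b}}) : set Omega :=
  \bigcap_(i in [set` L]) pi i @^-1` [set` A i].

Lemma measurable_cylinder L A : measurable (cylinder L A).
Proof.
apply: fin_bigcap_measurable; first exact: finite_seq.
by move=> i _; have [] := preimage_perm_set Ppi i (A i).
Qed.

Lemma cylinder_prob L A : uniq L ->
  P (cylinder L A) = (\prod_(i <- L) (#|A i|%:R / b`!%:R))%:E.
Proof.
move=> uL; have [_ _ /(_ L (fun i => [set` A i]) uL) PL] := Ppi.
apply: etrans PL _; rewrite -prodEFin; apply: eq_bigr => i _.
by have [_] := preimage_perm_set Ppi i (A i).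
Qed.

Definition coordinate_words (W : 'I_d -> seq (seq 'I_b)) :=
  [seq (j, w) | j <- enum 'I_d, w <- W j].

Lemma coordinate_wordsP W j w :
  ((j, w) \in coordinate_words W) = (w \in W j).
Proof.
apply/allpairsPdep/idP => [[j' [w' [_ ww [-> ->]]]] //|wW].
by exists j, w; rewrite mem_enum.
Qed.

Lemma uniq_coordinate_words W :
  (forall j, uniq (W j)) -> uniq (coordinate_words W).
Proof.
move=> uW; apply: allpairs_uniq_dep; first exact: enum_uniq.
  by move=> j _; exact: uW.
by move=> [j w] [j' w'] _ _ /= [-> ->].
Qed.

Lemma prod_coordinate_words W (f : 'I_d * seq 'I_b -> R) :
  \prod_(i <- coordinate_words W) f i = \prod_j \prod_(w <- W j) f (j, w).
Proof. by rewrite big_allpairs_dep big_enum. Qed.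

Variables (lo one hi : 'I_b) (K l : nat).
Hypothesis lo_one : lo != one.

Definition split_at (s : seq 'I_b) (al be : nat -> 'I_b) : Prop :=
  [/\ mkseq al K = s, mkseq be K = s, al K = lo & be K = one].

(** The prefixes whose permutations decide whether a pair is close in one
coordinate. *)
Definition pair_words (al be : nat -> 'I_b) : seq (seq 'I_b) :=
  mkseq al K :: [seq mkseq al (K.+1 + r) | r <- iota 0 l]
             ++ [seq mkseq be (K.+1 + r) | r <- iota 0 l].

(** A prefix [w] itself tells which condition applies, by its length and its
letter at [K], so that the conditions form one family indexed by prefixes. *)
Definition pair_constraint (al be : nat -> 'I_b) (w : seq 'I_b) :
    {set {perm 'I_b}} :=
  if size w == K then [set s : {perm 'I_b} | (s lo == lo) && (s one == one)]%SET
  else if nth lo w K == lo then [set s : {perm 'I_b} | s (al (size w)) == hi]%SET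
  else [set s : {perm 'I_b} | s (be (size w)) == lo]%SET.

Definition fix2_prob : R :=
  #|[set s : {perm 'I_b} | (s lo == lo) && (s one == one)]%SET|%:R / b`!%:R.

Lemma fix2_prob_gt0 : 0 < fix2_prob.
Proof.
rewrite divr_gt0 ?ltr0n ?fact_gt0 //; apply/card_gt0P; exists 1%g.
by rewrite inE !perm1 !eqxx.
Qed.

Definition pair_prob : R := fix2_prob * (b%:R^-1 ^+ l * b%:R^-1 ^+ l).

Lemma pair_words_take s al be w :
  split_at s al be -> w \in pair_words al be -> take K w = s.
Proof.
have tk (f : nat -> 'I_b) r : take K (mkseq f (K.+1 + r)) = mkseq f K.
  by rewrite /mkseq -map_take take_iota (minn_idPl _) //; lia.
move=> [als bes _ _]; rewrite in_cons mem_cat => /or3P[/eqP ->|/mapP|/mapP].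
- by rewrite als take_oversize // -als size_mkseq.
- by move=> [r _ ->]; rewrite tk.
- by move=> [r _ ->]; rewrite tk.
Qed.

Lemma pair_words_uniq s al be : split_at s al be -> uniq (pair_words al be).
Proof.
move=> [als bes alK beK].
have inj (f : nat -> 'I_b) : injective (fun r => mkseq f (K.+1 + r)).
  by move=> r r' /(congr1 size); rewrite !size_mkseq; lia.
rewrite /= mem_cat cat_uniq !map_inj_uniq ?iota_uniq // andbT /=.
apply/andP; split; last first.
  apply/hasPn => w /mapP[r _ ->]; apply/mapP => -[r' _].
  move=> /(congr1 (fun w => nth lo w K)).
  rewrite !nth_mkseq ?ltnS ?leq_addr // alK beK => e.
  by have := lo_one; rewrite e eqxx.
rewrite negb_or; apply/andP; split; apply/mapP => -[r _ /(congr1 size)];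
  by rewrite !size_mkseq; lia.
Qed.

Lemma card_pair_constraint al be w :
  #|pair_constraint al be w|%:R / b`!%:R =
  (if size w == K then fix2_prob else b%:R^-1) :> R.
Proof.
by rewrite /pair_constraint; case: ifP => // _; case: ifP => _;
   rewrite card_perm_letter.
Qed.

Lemma pair_words_prob al be (A : seq 'I_b -> {set {perm 'I_b}}) :
  (forall w, w \in pair_words al be -> A w = pair_constraint al be w) ->
  \prod_(w <- pair_words al be) (#|A w|%:R / b`!%:R) = pair_prob.
Proof.
move=> hA; rewrite (eq_big_seq (fun w : seq 'I_b =>
  if size w == K then fix2_prob else b%:R^-1)); last first.
  by move=> w /hA ->; rewrite card_pair_constraint.
have tail (f : nat -> 'I_b) :
    \prod_(w <- [seq mkseq f (K.+1 + r) | r <- iota 0 l])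
      (if size w == K then fix2_prob else b%:R^-1) = b%:R^-1 ^+ l.
  rewrite big_map (eq_bigr (fun=> b%:R^-1)); last first.
    by move=> r _; rewrite size_mkseq ifN //; lia.
  by rewrite big_const_seq count_predT size_iota iter_mulr_1.
by rewrite big_cons big_cat /= !tail size_mkseq eqxx.
Qed.

Lemma pair_prob_gt0 : 0 < pair_prob.
Proof.
have b0 : 0 < b%:R^-1 :> R.
  by rewrite invr_gt0 ltr0n (leq_ltn_trans (leq0n _) (ltn_ord lo)).
by rewrite mulr_gt0 ?fix2_prob_gt0 // mulr_gt0 // exprn_gt0.
Qed.

Local Notation cell := {ffun 'I_d -> K.-tuple 'I_b}.
Variables al be : cell -> 'I_d -> nat -> 'I_b.
Hypothesis split_cell : forall (u : cell) j, split_at (u j) (al u j) (be u j).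

Let words (u : cell) (j : 'I_d) := pair_words (al u j) (be u j).
Let constraint (u : cell) (i : 'I_d * seq 'I_b) :=
  pair_constraint (al u i.1) (be u i.1) i.2.

Definition pair_event u : set Omega :=
  cylinder (coordinate_words (words u)) (constraint u).

Lemma pair_event_prob u : P (pair_event u) = (pair_prob ^+ d)%:E.
Proof.
rewrite cylinder_prob; last first.
  by apply: uniq_coordinate_words => j; exact: pair_words_uniq (split_cell u j).
rewrite prod_coordinate_words (eq_bigr (fun=> pair_prob)); last first.
  by move=> j _; rewrite (pair_words_prob (al := al u j) (be := be u j)).
by rewrite prodr_const card_ord.
Qed.

(** In a coordinate where [u] and [v] agree, the conditions of [v] are dropped.
The remaining ones concern distinct prefixes, which are told apart by their first
[K] letters, so that the independence of the permutations applies. *)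
Lemma pair_event_joint u v :
  fine (P (pair_event u `&` pair_event v)) <=
  \prod_j (pair_prob * (if v j == u j then 1 else pair_prob)).
Proof.
pose W j := words u j ++ (if v j == u j then [::] else words v j).
pose A (i : 'I_d * seq 'I_b) :=
  if take K i.2 == u i.1 then constraint u i else constraint v i.
have Wtake w j z : w \in words z j -> take K w = z j.
  exact: pair_words_take (split_cell z j).
have uw z j : uniq (words z j) by exact: pair_words_uniq (split_cell z j).
have uW j : uniq (W j).
  rewrite cat_uniq uw; case: eqP => [|/eqP neq] //; rewrite uw andbT.
  apply/hasPn => w wv; apply: contra neq => wu; apply/eqP/val_inj.
  exact: etrans (esym (Wtake _ _ _ wv)) (Wtake _ _ _ wu).
have sub : pair_event u `&` pair_event v `<=` cylinder (coordinate_words W) A.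
  move=> w [wu wv] [j s] /=; rewrite coordinate_wordsP mem_cat /A /=.
  have su_eq z : s \in words z j -> pair_event z w -> pi (j, s) w \in constraint z (j, s).
    by move=> sz wz; have := wz (j, s); rewrite /= coordinate_wordsP; exact.
  have [su|nsu] := eqVneq (take K s) (u j).
    case/orP => [sW|]; first exact: su_eq.
    case: eqP => // neq sW; exfalso; apply: neq; apply: val_inj.
    exact: etrans (esym (Wtake _ _ _ sW)) su.
  case/orP => [sW|]; first by move: nsu; rewrite (Wtake _ _ _ sW) eqxx.
  by case: eqP => // _ sW; exact: su_eq.
have mE z : measurable (pair_event z) by exact: measurable_cylinder.
have mC : measurable (cylinder (coordinate_words W) A) by exact: measurable_cylinder.
have le : (P (pair_event u `&` pair_event v) <=
           P (cylinder (coordinate_words W) A))%E.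
  by apply: le_measure => //; rewrite inE //; exact: measurableI.
apply: (@le_trans _ _ (fine (P (cylinder (coordinate_words W) A)))).
  by apply: fine_le => //; apply: fin_num_measure => //; exact: measurableI.
rewrite cylinder_prob; last exact: uniq_coordinate_words.
rewrite /= prod_coordinate_words; apply: ler_prod => j _.
have b0 w : 0 <= #|A (j, w)|%:R / b`!%:R :> R by rewrite divr_ge0.
rewrite prodr_ge0 //= big_cat /= (pair_words_prob (al := al u j) (be := be u j)).
  case: eqP => [|neq]; first by rewrite big_nil.
  rewrite (pair_words_prob (al := al v j) (be := be v j)) // => w wv.
  rewrite /A /= (Wtake _ _ _ wv) ifN //; apply/eqP => e; apply: neq.
  exact: val_inj.
by move=> w wu; rewrite /A /= (Wtake _ _ _ wu) eqxx.
Qed.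

(** The [b ^ K] blocks along one coordinate contribute [lam = b ^ K * p] to the
mean, where [p = pair_prob]; both moments factor over the [d] coordinates, as
[lam ^ d] and at most [(lam + lam ^ 2) ^ d]. *)
Lemma no_pair_prob (F : set Omega) : measurable F ->
  (forall u w, F w -> ~ pair_event u w) ->
  fine (P F) <= (1 + ((b ^ K)%:R * pair_prob)^-1) ^+ d - 1.
Proof.
move=> mF FE; set p := pair_prob; set M : R := (b ^ K)%:R.
have p0 : 0 < p := pair_prob_gt0.
have M0 : 0 < M.
  by rewrite ltr0n expn_gt0 (leq_ltn_trans (leq0n _) (ltn_ord lo)).
have := second_moment (fun u => measurable_cylinder _ _) mF FE pair_event_prob
          pair_event_joint.
have -> : #|cell|%:R * p ^+ d = (M * p) ^+ d :> R.
  by rewrite card_ffun card_tuple !card_ord natrX -exprMn.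
have S2 (u : cell) : \sum_(v : cell) \prod_j (p * (if v j == u j then 1 else p)) <=
    (p + M * p ^+ 2) ^+ d.
  rewrite -(bigA_distr_bigA (fun j (s : K.-tuple 'I_b) =>
    p * (if s == u j then 1 else p))) /=.
  rewrite -[d in leRHS]card_ord -prodr_const; apply: ler_prod => j _.
  have p01 s : 0 <= p * (if s == u j then 1 else p).
    by apply: mulr_ge0; [exact: ltW | case: ifP => // _; exact: ltW].
  rewrite sumr_ge0 //= (bigD1 (u j)) //= eqxx mulr1 lerD2l.
  rewrite (eq_bigr (fun=> p ^+ 2)); last by move=> s /negPf ->; rewrite expr2.
  rewrite sumr_const -mulr_natl ler_wpM2r ?sqr_ge0 // ler_nat.
  by rewrite (leq_trans (max_card _)) // card_tuple card_ord.
set lam := M * p; have lam0 : 0 < lam by exact: mulr_gt0.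
have lamd0 : 0 < (lam ^+ d) ^+ 2 by rewrite !exprn_gt0.
have S : \sum_(u : cell) (p + M * p ^+ 2) ^+ d =
    (lam ^+ d) ^+ 2 * (1 + lam^-1) ^+ d.
  rewrite sumr_const card_ffun card_tuple !card_ord -mulr_natl natrX -/M -exprMn.
  rewrite exprAC -exprMn; congr (_ ^+ d); rewrite /lam.
  by field; rewrite !gt_eqF.
move=> /le_trans /(_ (ler_sum _ (fun u _ => S2 u))); rewrite S.
rewrite -[X in _ + X <= _]mulr1 -mulrDr ler_pM2l //; lra.
Qed.

End PairEvents.

(** * Every scale has a close pair with high probability *)

Section ClosePairs.
Variables (R : realType) (b d : nat) (disp : measure_display).
Variables (Omega : measurableType disp) (P : probability Omega R).
Variable pi : 'I_d * seq 'I_b -> Omega -> {perm 'I_b}.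
Hypothesis Ppi : owen_permutations P pi.
Variables (lo one hi : 'I_b).
Hypotheses (lo0 : lo = 0%N :> nat) (one1 : one = 1%N :> nat).
Hypothesis hi_top : hi = b.-1 :> nat.

(** A scrambled digit depends only on the digits up to it, so the two scrambled
sequences still agree before [K]; then a carry separates them. *)
Lemma scramble_pair_dist (K l : nat) (s : seq 'I_b) (p : seq 'I_b -> {perm 'I_b})
    (al be : nat -> 'I_b) :
  split_at lo one K s al be ->
  (forall w, w \in pair_words K l al be ->
    p w \in pair_constraint lo one hi K al be w) ->
  `|digit_value R (scramble_digits p al) - digit_value R (scramble_digits p be)|
    <= 2 / b%:R ^+ (K.+1 + l).
Proof.
move=> [als bes alK beK] hp; apply: adjacent_prefix_dist.
have pre r : (r < K)%N -> al r = be r.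
  move=> rK; have := congr1 (fun s => nth lo s r) (etrans als (esym bes)).
  by rewrite !nth_mkseq.
have split_perm : (p s lo == lo) && (p s one == one).
  have := hp s; rewrite /pair_words /pair_constraint -als size_mkseq eqxx.
  by rewrite in_cons eqxx inE; exact.
have /andP[/eqP plo /eqP pone] := split_perm.
have tail (f : nat -> 'I_b) r : size (mkseq f (K.+1 + r)) != K.
  by rewrite size_mkseq; lia.
have tailK (f : nat -> 'I_b) r : nth lo (mkseq f (K.+1 + r)) K = f K.
  by rewrite nth_mkseq // ltnS leq_addr.
have one_lo : (one == lo) = false by apply/eqP => e; move: one1; rewrite e lo0.
apply: carry_prefix_num.
- move=> r rK; rewrite /scramble_digits pre //; congr (p _ _).
  apply/eq_in_map => i; rewrite mem_iota add0n => /andP[_ ir].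
  by rewrite pre // (ltn_trans ir).
- by rewrite /scramble_digits als alK plo.
- by rewrite /scramble_digits bes beK pone.
- move=> r rl; rewrite /scramble_digits -hi_top.
  have := hp (mkseq al (K.+1 + r)); rewrite in_cons mem_cat.
  rewrite (map_f (fun r => mkseq al (K.+1 + r))) ?mem_iota // orbT => /(_ isT).
  rewrite /pair_constraint ifN // tailK alK eqxx inE size_mkseq => /eqP.
  by move=> ->.
- move=> r rl; rewrite /scramble_digits -lo0.
  have := hp (mkseq be (K.+1 + r)); rewrite in_cons mem_cat.
  rewrite (map_f (fun r => mkseq be (K.+1 + r))) ?mem_iota // !orbT => /(_ isT).
  rewrite /pair_constraint ifN // tailK beK one_lo inE size_mkseq => /eqP.
  by move=> ->.
Qed.

(** [F] is the event that none of the [b ^ (K * d)] pairs, chosen before the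
scrambling, becomes close. *)
Lemma close_pair_exists (t : nat) (x : nat -> 'rV[R]_d)
    (a : nat -> 'I_d -> nat -> 'I_b) (K l : nat) :
  (2 <= b)%N -> (1 <= d)%N -> is_td_sequence b t x ->
  (forall n j, x n 0 j = digit_value R (a n j)) ->
  exists F : set Omega, [/\ measurable F,
    fine (P F) <= (1 + ((b ^ K)%:R * pair_prob R lo one l)^-1) ^+ d - 1 &
    forall w, ~ F w -> exists X Y, [/\ (X < b ^ (K.+2 * d + t))%N,
      (Y < b ^ (K.+2 * d + t))%N, X != Y &
      `|owen_scramble R pi a w X - owen_scramble R pi a w Y|
        <= 2 / b%:R ^+ (K.+1 + l)]].
Proof.
move=> hb hd tdx xa.
have lo_one : lo != one by apply/eqP => e; move: one1; rewrite -e lo0.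
have point (c : 'I_b) (u : {ffun 'I_d -> K.-tuple 'I_b}) :
    exists n, (n < b ^ (K.+2 * d + t))%N /\
      forall j, mkseq (a n j) K = u j /\ a n j K = c.
  have [j|n nN hn] := td_sequence_prefix hb (D := K.+1)
    (s := fun j => rcons (u j) c) tdx xa.
    by rewrite size_rcons size_tuple.
  exists n; split=> // j; have := hn j; rewrite mkseqS.
  by move=> /rcons_inj[-> ->].
have [X hX] := choice (point lo); have [Y hY] := choice (point one).
have split_cell (u : {ffun 'I_d -> K.-tuple 'I_b}) j :
    split_at lo one K (u j) (a (X u) j) (a (Y u) j).
  by have [_ /(_ j)[? ?]] := hX u; have [_ /(_ j)[? ?]] := hY u.
pose E u := pair_event pi lo one hi l (fun u => a (X u)) (fun u => a (Y u)) u.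
have mE (u : {ffun 'I_d -> K.-tuple 'I_b}) : measurable (E u).
  exact: (measurable_cylinder Ppi).
pose F := \bigcap_(u in [set: {ffun 'I_d -> K.-tuple 'I_b}]) ~` E u.
have mF : measurable F.
  apply: fin_bigcap_measurable; first exact: finite_finset.
  by move=> u _; exact: measurableC.
exists F; split=> //.
  by apply: (no_pair_prob Ppi lo_one split_cell mF) => u w Fw; exact: Fw.
move=> w nFw.
have [u Eu] : exists u, E u w.
  by apply: contrapT => /forallNP nE; apply: nFw => u _; exact: nE.
have [XN _] := hX u; have [YN _] := hY u.
exists (X u), (Y u); split=> //.
  apply/eqP => e; have [_ /(_ (Ordinal hd))[_ Xlo]] := hX u.
  have [_ /(_ (Ordinal hd))[_]] := hY u.
  by rewrite -e Xlo => /eqP; rewrite (negPf lo_one).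
apply: row_norm_le => [|j]; first by rewrite divr_ge0 // exprn_ge0.
rewrite !mxE; apply: scramble_pair_dist (split_cell u j) _ => s sW.
by have := Eu (j, s); rewrite /= coordinate_wordsP; exact.
Qed.

End ClosePairs.

(** * The gauge and the choice of the tail length *)

Section Growth.
Variable R : realType.
Implicit Types x y eps : R.

Lemma ln_le_sub1 y : 0 < y -> ln y <= y - 1.
Proof.
by move=> y0; have := @le_ln1Dx R (y - 1); rewrite addrCA subrr addr0; apply; lra.
Qed.

Lemma ln_ge_subV y : 0 < y -> 1 - y^-1 <= ln y.
Proof.
move=> y0; have := @ln_le_sub1 y^-1; rewrite invr_gt0 lnV ?posrE // => /(_ y0).
lra.
Qed.

Lemma ln2_ge_half : 2^-1 <= ln 2 :> R.
Proof. by have := @ln_ge_subV 2; lra. Qed.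

Lemma ln_ge1 x : 4 <= x -> 1 <= ln x.
Proof.
move=> x4; apply: (@le_trans _ _ (ln 4)); last by rewrite ler_ln ?posrE //; lra.
have -> : 4 = 2 * 2 :> R by ring.
by rewrite lnM ?posrE //; have := ln2_ge_half; lra.
Qed.

(** Almost the slowest growth with summable reciprocals; the shift by [4] makes
both factors at least [1]. *)
Definition gauge eps (K : nat) : R := (K + 4)%:R * ln (K + 4)%:R `^ (1 + eps).

Lemma gauge_base (K : nat) : 4 <= (K + 4)%:R :> R.
Proof. by rewrite ler_nat leq_addl. Qed.

Lemma gauge_ge1 eps K : 0 < eps -> 1 <= gauge eps K.
Proof.
move=> eps0; have K4 := gauge_base K; have lK := ln_ge1 K4.
rewrite -[leLHS]mulr1 ler_pM //; first by lra.
by rewrite -[leLHS](powRr0 (ln (K + 4)%:R)) ler_powR //; lra.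
Qed.

(** The graph of the convex function [z ^ -eps] lies above its tangent at [y].
This makes the reciprocals of the gauge smaller than the terms of a telescoping
sum. *)
Lemma powR_diff_ge eps x y : 0 < eps -> 0 < x -> 0 < y ->
  eps * (y - x) * y `^ (- (1 + eps)) <= x `^ (- eps) - y `^ (- eps).
Proof.
move=> eps0 x0 y0.
have yx : 0 < x / y by rewrite divr_gt0.
have -> : x `^ (- eps) = (x / y) `^ (- eps) * y `^ (- eps).
  by rewrite -powRM ?divfK ?gt_eqF ?ltW.
have -> : y `^ (- (1 + eps)) = y^-1 * y `^ (- eps).
  by rewrite opprD powRD ?(gt_eqF y0) ?implybT // powR_inv1 ?ltW.
rewrite -[X in _ <= _ - X]mul1r -mulrBl mulrA ler_pM2r ?powR_gt0 //.
have : 1 + eps * (1 - x / y) <= (x / y) `^ (- eps).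
  rewrite /powR gt_eqF //.
  apply: le_trans (expR_ge1Dx _); rewrite lerD2l mulNr -mulrN ler_pM2l //.
  by have := ln_le_sub1 yx; lra.
have -> : eps * (y - x) / y = eps * (1 - x / y) by field; rewrite gt_eqF.
lra.
Qed.

Lemma gauge_summable eps : 0 < eps ->
  exists2 C, 0 < C & forall n, \sum_(0 <= K < n) (gauge eps K)^-1 <= C.
Proof.
move=> eps0; pose T (K : nat) : R := ln (K + 4)%:R `^ (- eps) / eps.
have T0 K : 0 <= T K by rewrite divr_ge0 ?powR_ge0 // ltW.
have g0 K : 0 < gauge eps K by rewrite (lt_le_trans ltr01) ?gauge_ge1.
have step K : (gauge eps K.+1)^-1 <= T K - T K.+1.
  have K4 := gauge_base K; have K5 := gauge_base K.+1.
  have lK := ln_ge1 K4; have lK1 := ln_ge1 K5.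
  have k1 : (K.+1 + 4)%:R = (K + 4)%:R + 1 :> R by rewrite natr1 addSn.
  have dln : (K.+1 + 4)%:R^-1 <= ln (K.+1 + 4)%:R - ln (K + 4)%:R :> R.
    rewrite -ln_div ?posrE; try lra.
    apply: le_trans (ln_ge_subV _); last by rewrite divr_gt0 //; lra.
    by rewrite invf_div k1 -[X in X - _](@divff _ ((K + 4)%:R + 1)) ?gt_eqF; try lra;
       rewrite -mulrBl addrAC subrr add0r mul1r.
  have h := powR_diff_ge eps0 (lt_le_trans ltr01 lK) (lt_le_trans ltr01 lK1).
  rewrite /T -mulrBl ler_pdivlMr // mulrC; apply: le_trans h.
  rewrite -mulrA ler_pM2l // /gauge invfM powRN.
  by rewrite ler_wpM2r // invr_ge0 powR_ge0.
exists ((gauge eps 0)^-1 + T 0%N); first by rewrite ltr_wpDr // invr_gt0.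
case=> [|n]; first by rewrite big_geq // addr_ge0 ?invr_ge0 // ltW.
rewrite big_nat_recl //= lerD2l.
apply: (@le_trans _ _ (T 0%N - T n)); last by rewrite gerBl.
elim: n => [|n IH]; first by rewrite big_geq // subrr.
by rewrite big_nat_recr //=; have := step n; lra.
Qed.

(** The factors are compared through their logarithms: [ln] lies below each of
its tangents, in particular below [eta * y - 1 - ln eta] for any slope
[eta > 0]. *)
Lemma gauge_le_expn eps (b : nat) : 0 < eps -> (2 <= b)%N ->
  exists K0, forall K, (K0 <= K)%N -> gauge eps K <= b%:R ^+ K.
Proof.
move=> eps0 hb; have bN : (0 < b)%N := ltnW hb.
(* [eta] is chosen so that the slope [c * eta = 1/4] stays below [ln b]. *)
pose c : R := 2 + eps; have c0 : 0 < c by rewrite /c; lra.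
pose eta : R := (4 * c)^-1; have eta0 : 0 < eta by rewrite invr_gt0 mulr_gt0.
pose C : R := 1 - c * (1 + ln eta).
have [K0 hK0] : exists K0 : nat, 4 * C <= K0%:R.
  by exists (Num.truncn (4 * C)).+1; exact: ltW (truncnS_gt _).
exists K0 => K KK0.
have K4 := gauge_base K; have lK := ln_ge1 K4.
have bK0 : 0 < b%:R ^+ K :> R by rewrite exprn_gt0 // ltr0n; lia.
have g0 : 0 < gauge eps K by rewrite (lt_le_trans ltr01) ?gauge_ge1.
rewrite -ler_ln ?posrE // lnXn ?ltr0n; last by lia.
rewrite /gauge lnM ?posrE ?powR_gt0; try lra.
rewrite ln_powR; set y := ln (K + 4)%:R in lK *.
have lny : ln y <= y by have := @ln_le_sub1 y; lra.
have yb : y <= eta * (K + 4)%:R - 1 - ln eta.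
  have := @ln_le_sub1 (eta * (K + 4)%:R).
  rewrite mulr_gt0 // ?lnM ?posrE //; try lra.
  by move=> /(_ isT); rewrite -/y; lra.
have cy : y + (1 + eps) * ln y <= c * y by rewrite /c; nra.
have ceta : c * eta = 4^-1 by rewrite /eta; field; lra.
have cyb : c * y <= 4^-1 * (K + 4)%:R - c * (1 + ln eta).
  apply: (@le_trans _ _ (c * (eta * (K + 4)%:R - 1 - ln eta))).
    by rewrite ler_pM2l.
  by rewrite -ceta; lra.
have lnb : 2^-1 <= ln b%:R :> R.
  by apply: le_trans ln2_ge_half _; rewrite ler_ln ?posrE ?ltr0n ?ler_nat.
have Kb : 2^-1 * K%:R <= ln b%:R *+ K :> R.
  by rewrite -[leRHS]mulr_natr ler_wpM2r.
have KC : 4 * C <= K%:R by apply: le_trans hK0 _; rewrite ler_nat.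
move: cyb KC; rewrite /C natrD; lra.
Qed.

(** [l] is the largest tail length for which [b ^ (K - 2 * l)] still dominates
the gauge. *)
Lemma tail_length eps (b : nat) : 0 < eps -> (2 <= b)%N ->
  exists l : nat -> nat,
    (forall K, b%:R ^+ K <= b%:R ^+ (2 * (l K).+1) * gauge eps K) /\
    exists K0, forall K, (K0 <= K)%N ->
      b%:R ^+ (2 * l K) * gauge eps K <= b%:R ^+ K.
Proof.
move=> eps0 hb; have b1 : 1 <= b%:R :> R by rewrite ler1n; lia.
pose Q K n := b%:R ^+ K <= b%:R ^+ (2 * n.+1) * gauge eps K.
have exQ K : exists n, Q K n.
  exists K; apply: (@le_trans _ _ (b%:R ^+ (2 * K.+1))).
    by rewrite ler_weXn2l //; lia.
  by rewrite -[leLHS]mulr1 ler_wpM2l ?exprn_ge0 ?gauge_ge1.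
exists (fun K => ex_minn (exQ K)); split=> [K|]; first by case: ex_minnP.
have [K0 hK0] := gauge_le_expn eps0 hb; exists K0 => K KK0.
(* When the least [l] is [0], there is no smaller value to compare with, and the
bound is the growth of [b ^ K]. *)
case: ex_minnP => -[|n] _ min; first by rewrite muln0 expr0 mul1r hK0.
rewrite leNgt; apply/negP => lt.
by have := min n (ltW lt); rewrite ltnn.
Qed.

Lemma expn1D_linear (d : nat) (X : R) : 0 <= X ->
  exists2 D, 0 <= D & forall x, 0 <= x -> x <= X -> (1 + x) ^+ d - 1 <= D * x.
Proof.
move=> X0; elim: d => [|d [D D0 hD]].
  by exists 0 => // x _ _; rewrite expr0 subrr mul0r.
exists (D + 1 + D * X); first by rewrite !addr_ge0 ?mulr_ge0.
move=> x x0 xX; have hx := hD x x0 xX; rewrite exprS.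
have h1 : (1 + x) * (1 + x) ^+ d <= (1 + x) * (1 + D * x).
  by rewrite ler_wpM2l; lra.
have h2 : D * x * x <= D * x * X by rewrite ler_wpM2l // mulr_ge0.
lra.
Qed.

End Growth.

(** * The rate as a function of the number of points *)

Section Rate.
Variable R : realType.

Definition rate (d : nat) (eps : R) (n : nat) : R :=
  n%:R `^ (1 / (2 * d%:R)) * ln n%:R `^ (- (1 / 2))
    * ln (2 + ln n%:R) `^ (- ((1 + eps) / 2)).

Lemma powR_half_sqr (x r : R) : (x `^ (r / 2)) ^+ 2 = x `^ r.
Proof. by rewrite -powR_mulrn ?powR_ge0 // -powRrM divfK. Qed.

(** If [b ^ (d * K)] is comparable with [n], then [K] is at most a multiple of
[ln n], and [b ^ l], which is of the order of the square root of [b ^ K] over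
the gauge at [K], has at least the order of the rate at [n]. *)
Lemma rate_le_tail (b d t : nat) (eps : R) :
  (2 <= b)%N -> (1 <= d)%N -> 0 < eps ->
  exists2 c, 0 < c & forall K l n : nat,
    (b ^ (K.+2 * d + t) <= n)%N -> (n < b ^ (K.+3 * d + t))%N ->
    b%:R ^+ K <= b%:R ^+ (2 * l.+1) * gauge eps K ->
    c * rate d eps n <= b%:R ^+ l / (2 * b%:R ^+ (2 + t)).
Proof.
move=> hb hd eps0; have bN : (0 < b)%N := ltnW hb.
have bX m : (0 < b ^ m)%N by rewrite expn_gt0 bN.
have e_lo K : (K.+2 <= K.+2 * d + t)%N by nia.
have e_hi K : (K.+3 * d + t <= (K + (3 + t)) * d)%N by nia.
have d0 : d%:R != 0 :> R by rewrite pnatr_eq0 -lt0n.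
have b0 : 0 < b%:R :> R by rewrite ltr0n.
have b1 : 1 <= b%:R :> R by rewrite ler1n.
pose G : R := b%:R ^+ (3 + t) * (4 * 2 `^ (1 + eps)).
have G0 : 0 < G.
  by apply: mulr_gt0; [exact: exprn_gt0 | apply: mulr_gt0 => //; exact: powR_gt0].
pose s : R := Num.sqrt G^-1; have s0 : 0 < s by rewrite sqrtr_gt0 invr_gt0.
have B0 : 0 < 2 * b%:R ^+ (2 + t) :> R by rewrite mulr_gt0 ?exprn_gt0.
exists (s / b%:R / (2 * b%:R ^+ (2 + t))); first by rewrite !divr_gt0.
move=> K l n nlo nhi hl.
rewrite [leLHS]mulrAC ler_pM2r ?invr_gt0 // mulrAC ler_pdivrMr // -exprSr.
have KL : (K.+2)%:R <= 2 * ln n%:R :> R.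
  have : ln (b ^ K.+2)%:R <= ln n%:R :> R.
    rewrite ler_ln ?posrE ?ltr0n ?bX ?ler_nat //; last exact: leq_trans nlo.
    by apply: leq_trans nlo; rewrite leq_exp2l.
  rewrite natrX lnXn // -[_ *+ _]mulr_natr.
  have : 2^-1 * K.+2%:R <= ln b%:R * K.+2%:R :> R.
    rewrite ler_wpM2r //; apply: le_trans (ln2_ge_half R) _.
    by rewrite ler_ln ?posrE // ler_nat.
  by lra.
set L := ln n%:R in KL *; set M := ln (2 + L).
have K2 : 2 <= K.+2%:R :> R by rewrite ler_nat.
have L1 : 1 <= L by lra.
have M0 : 0 < M by rewrite ln_gt0 //; lra.
have K4 := gauge_base R K; have lK := ln_ge1 K4.
have k24 : (K + 4)%:R = K.+2%:R + 2 :> R by rewrite natrD -[in RHS]addn2 natrD; ring.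
have lnK : ln (K + 4)%:R <= 2 * M.
  have -> : 2 * M = ln ((2 + L) * (2 + L)).
    by rewrite lnM ?posrE -/M; [ring | lra | lra].
  by rewrite ler_ln ?posrE; nra.
have gL : gauge eps K <= 4 * 2 `^ (1 + eps) * (L * M `^ (1 + eps)).
  rewrite mulrACA -powRM //; last by rewrite ltW.
  apply: ler_pM; [lra | exact: powR_ge0 | lra |].
  by apply: ge0_ler_powR => //; rewrite ?nnegrE; lra.
have n0 : 0 < n%:R :> R.
  by rewrite ltr0n; exact: leq_trans nlo.
have nb : n%:R `^ (d%:R^-1) <= b%:R ^+ K * b%:R ^+ (3 + t) :> R.
  rewrite -exprD.
  have -> : b%:R ^+ (K + (3 + t)) = ((b ^ ((K + (3 + t)) * d))%:R) `^ (d%:R^-1) :> R.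
    have Bm : 0 <= b%:R ^+ (K + (3 + t)) :> R by rewrite exprn_ge0 // ltW.
    by rewrite natrX exprM -[in RHS](powR_mulrn _ Bm) -powRrM mulfV // powRr1.
  apply: ge0_ler_powR; rewrite ?invr_ge0 ?nnegrE // ler_nat.
  by apply: leq_trans (ltnW nhi) _; rewrite leq_exp2l.
pose W := rate d eps n; have W0 : 0 <= W by rewrite !mulr_ge0 ?powR_ge0.
have W2 : W ^+ 2 * (L * M `^ (1 + eps)) = n%:R `^ (d%:R^-1).
  have -> : W ^+ 2 = n%:R `^ (d%:R^-1) * L^-1 * (M `^ (1 + eps))^-1.
    rewrite /W /rate -/L -/M !exprMn.
    rewrite [1 / (2 * _)](_ : _ = d%:R^-1 / 2); last by field.
    rewrite [- (1 / 2)](_ : _ = (-1) / 2); last by field.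
    rewrite [- ((1 + eps) / 2)](_ : _ = (- (1 + eps)) / 2); last by field.
    by rewrite !powR_half_sqr powRN powR_inv1 //; lra.
  by field; rewrite !gt_eqF ?powR_gt0 //; lra.
have s2 : s ^+ 2 = G^-1 by rewrite sqr_sqrtr // invr_ge0 ltW.
have sW0 : 0 <= s * W by exact: mulr_ge0 (ltW s0) W0.
have bl0 : 0 <= b%:R ^+ l.+1 :> R by rewrite exprn_ge0 // ltW.
rewrite -/W -(@ler_pXn2r _ 2) ?nnegrE //.
have LM0 : 0 < L * M `^ (1 + eps) by rewrite mulr_gt0 ?powR_gt0 //; lra.
rewrite exprMn s2 mulrC ler_pdivrMr // -(ler_pM2r LM0) W2.
apply: le_trans nb _; rewrite -exprM mulnC.
have B3 : 0 <= b%:R ^+ (3 + t) :> R by rewrite exprn_ge0 // ltW.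
apply: le_trans (ler_wpM2r B3 hl) _.
have Bl : 0 <= b%:R ^+ (2 * l.+1) :> R by rewrite exprn_ge0 // ltW.
have := ler_wpM2r B3 (ler_wpM2l Bl gL); rewrite /G => /le_trans; apply.
by rewrite le_eqVlt; apply/orP; left; apply/eqP; ring.
Qed.

(** With [L = ln n], the first factor is at least a multiple of [L ^ 3], and the
other two cost at most a multiple of [L ^ 2]. *)
Lemma rate_unbounded (d : nat) (c A : R) : (1 <= d)%N -> 0 < c ->
  exists n0, forall n, (n0 <= n)%N -> A <= c * rate d 1 n.
Proof.
move=> hd c0; have d0 : 0 < d%:R :> R by rewrite ltr0n.
pose e : R := 1 / (2 * d%:R); have e0 : 0 < e by rewrite divr_gt0 // mulr_gt0.
pose k : R := c * (e ^+ 3 / 6 / 3); have k0 : 0 < k.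
  by rewrite mulr_gt0 // !divr_gt0 // exprn_gt0.
pose L0 : R := Num.max 1 (A / k).
exists (Num.truncn (expR L0)).+1 => n hn.
have nL0 : expR L0 <= n%:R.
  by apply: le_trans (ltW (truncnS_gt _)) _; rewrite ler_nat.
have n0 : 0 < n%:R :> R by rewrite (lt_le_trans (expR_gt0 _) nL0).
have LL0 : L0 <= ln n%:R by rewrite -[leLHS]expRK ler_ln ?posrE ?expR_gt0.
rewrite /rate; set L := ln n%:R in LL0 *.
have [L1 AL] : 1 <= L /\ A / k <= L.
  by split; apply: le_trans LL0; rewrite /L0 le_max lexx ?orbT.
have f1 : (e * L) ^+ 3 / 6 <= n%:R `^ (1 / (2 * d%:R)).
  rewrite /powR gt_eqF // -/e -/L.
  have := @expR_ge1Dxn R (e * L) 2; rewrite mulr_ge0; [|lra|lra] => /(_ isT).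
  by rewrite (_ : 3`!%:R = 6) //; lra.
have f2 : L^-1 <= L `^ (- (1 / 2)).
  by rewrite -powR_inv1; [apply: ler_powR | ]; lra.
have f3 : (3 * L)^-1 <= ln (2 + L) `^ (- ((1 + 1) / 2)).
  have lnp : 0 < ln (2 + L) by rewrite ln_gt0 //; lra.
  rewrite (_ : - ((1 + 1) / 2) = -1); last by field.
  rewrite powR_inv1 ?(ltW lnp) // lef_pV2 ?posrE //; last by lra.
  by have := @ln_le_sub1 R (2 + L); lra.
have L0' : 0 < L by lra.
apply: (@le_trans _ _ (c * ((e * L) ^+ 3 / 6 * L^-1 * (3 * L)^-1))).
  have -> : c * ((e * L) ^+ 3 / 6 * L^-1 * (3 * L)^-1) = k * L.
    by rewrite /k; field; rewrite gt_eqF.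
  by move: AL; rewrite ler_pdivrMr // mulrC.
rewrite ler_pM2l // ler_pM ?ler_pM //.
- by rewrite !mulr_ge0 ?invr_ge0 ?exprn_ge0 ?mulr_ge0 //; lra.
- by rewrite invr_ge0; lra.
- by rewrite mulr_ge0 ?exprn_ge0 ?mulr_ge0 //; lra.
- by rewrite invr_ge0; lra.
Qed.

End Rate.

(** * Almost sure behaviour *)

Lemma borel_cantelli (R : realType) (disp : measure_display)
    (Omega : measurableType disp) (P : probability Omega R)
    (F : nat -> set Omega) (C : R) :
  (forall k, measurable (F k)) ->
  (forall n, \sum_(0 <= k < n) fine (P (F k)) <= C) ->
  {ae P, forall w, exists k0, forall k, (k0 <= k)%N -> ~ F k w}.
Proof.
move=> mF PF.
have msup : measurable (lim_sup_set F).
  apply: bigcap_measurable; first by exists 0%N.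
  by move=> n _; apply: bigcup_measurable => k _; exact: mF.
have sum_fin : (\sum_(0 <= k <oo) P (F k) < +oo)%E.
  apply: (@le_lt_trans _ _ C%:E); last exact: ltry.
  apply: lime_le; first by apply: is_cvg_nneseries => n _ _; exact: measure_ge0.
  near=> n; rewrite (eq_bigr (fun k => (fine (P (F k)))%:E)); last first.
    by move=> k _; rewrite fineK // fin_num_measure.
  by rewrite sumEFin lee_fin.
have PF0 := lim_sup_set_cvg0 mF sum_fin.
apply: negligibleS (_ : P.-negligible (lim_sup_set F)); last first.
  exact/negligibleP.
move=> w /= nw n _ /=; apply: contrapT => nF; apply: nw; exists n => k nk Fk.
by apply: nF; exists k.
Unshelve. all: by end_near. Qed.

Section Asymptotics.
Variables (R : realType) (b d t : nat).
Hypotheses (hb : (2 <= b)%N) (hd : (1 <= d)%N).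

Lemma mesh_ratio_ge_close_pair (y : nat -> 'rV[R]_d) (K l n X Y : nat) :
  (b ^ (K.+2 * d + t) <= n)%N -> (n < b ^ (K.+3 * d + t))%N ->
  (X < b ^ (K.+2 * d + t))%N -> (Y < b ^ (K.+2 * d + t))%N -> X != Y ->
  `|y X - y Y| <= 2 / b%:R ^+ (K.+1 + l) ->
  ((b%:R ^+ l / (2 * b%:R ^+ (2 + t)))%:E <= mesh_ratio (initial_segment y n))%E.
Proof.
move=> nlo nhi hX hY XY close.
have b0 : 0 < b%:R :> R by rewrite ltr0n; lia.
have n0 : (0 < n)%N by apply: leq_ltn_trans (leq_trans hX nlo).
have nM : (n < (b ^ (K.+3 + t)) ^ d)%N.
  by rewrite -expnM (leq_trans nhi) // leq_exp2l //; nia.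
have fill := fill_distance_ge (initial_segment y n) n0 nM.
have sep : separation_radius (initial_segment y n) <= (b%:R ^+ (K.+1 + l))^-1.
  apply: le_trans (@separation_radius_le _ _ _ _ (Ordinal (leq_trans hX nlo))
    (Ordinal (leq_trans hY nlo)) XY) _.
  rewrite /initial_segment /=; have := ler_wpM2l _ close => /(_ 2^-1).
  by rewrite invr_ge0 mulrA mulVf // mul1r; apply.
have q0 : 0 < (b%:R ^+ (K.+1 + l))^-1 :> R by rewrite invr_gt0 exprn_gt0.
have h0 : 0 <= (2 * (b ^ (K.+3 + t))%:R)^-1 :> R by rewrite invr_ge0 mulr_ge0.
apply: le_trans (mesh_ratio_ge h0 q0 fill sep).
rewrite lee_fin natrX invrK le_eqVlt; apply/orP; left; apply/eqP.
rewrite [(K.+3 + t)%N](_ : _ = (K.+1 + (2 + t))%N); last by lia.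
by rewrite !(exprD _ K.+1); field; rewrite !expf_neq0 ?gt_eqF.
Qed.

Lemma ex_scale (K0 n : nat) : (b ^ (K0.+2 * d + t) <= n)%N ->
  exists K, [/\ (K0 <= K)%N, (b ^ (K.+2 * d + t) <= n)%N &
    (n < b ^ (K.+3 * d + t))%N].
Proof.
move=> hn; have ex : exists K, (b ^ (K.+2 * d + t) <= n)%N by exists K0.
have bnd K : (b ^ (K.+2 * d + t) <= n)%N -> (K <= n)%N.
  apply: leq_trans; apply: ltnW; apply: leq_trans (ltn_expl _ hb) _.
  by rewrite leq_exp2l //; nia.
case: (ex_maxnP ex bnd) => K hK maxK; exists K; split=> //; first exact: maxK.
by rewrite ltnNge; apply/negP => /maxK; rewrite ltnn.
Qed.

(** With the tail lengths of [tail_length], the scales without a close pair have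
summable probabilities. *)
Lemma mesh_ratio_rate (eps : R) : 0 < eps ->
  exists2 c : R, 0 < c &
    forall (disp : measure_display) (Omega : measurableType disp)
      (P : probability Omega R)
      (x : nat -> 'rV[R]_d) (a : nat -> 'I_d -> nat -> 'I_b)
      (pi : 'I_d * seq 'I_b -> Omega -> {perm 'I_b}),
      is_td_sequence b t x ->
      (forall n j, x n 0 j = digit_value R (a n j)) ->
      owen_permutations P pi ->
      {ae P, forall w, exists n0 : nat, forall n : nat, (n0 <= n)%N ->
         ((c * rate d eps n)%:E
          <= mesh_ratio (initial_segment (owen_scramble R pi a w) n))%E}.
Proof.
move=> eps0; have [c c0 hc] := rate_le_tail t hb hd eps0; exists c => //.
move=> disp Omega P x a pi tdx xa Ppi.
have b0 : 0 < b%:R :> R by rewrite ltr0n; lia.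
have [l [l_lo [K0 l_hi]]] := tail_length eps0 hb.
pose lo : 'I_b := Ordinal (ltnW hb); pose one : 'I_b := Ordinal hb.
have hi_lt : (b.-1 < b)%N by lia.
pose hi : 'I_b := Ordinal hi_lt.
have [F hF] := choice (fun K => close_pair_exists Ppi (erefl : lo = 0%N :> nat)
  (erefl : one = 1%N :> nat) (erefl : hi = b.-1 :> nat) K (l K) hb hd tdx xa).
(* Below [K0] the tail length need not keep the failure probability small. *)
pose F' K := if (K0 <= K)%N then F K else set0.
have mF' K : measurable (F' K).
  by rewrite /F'; case: ifP => _; [case: (hF K) | exact: measurable0].
pose f := fix2_prob R lo one; have f0 : 0 < f := fix2_prob_gt0 R lo one.
have [D D0 hD] : exists2 D : R, 0 <= D & forall z, 0 <= z -> z <= f^-1 ->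
    (1 + z) ^+ d - 1 <= D * z by apply: expn1D_linear; rewrite invr_ge0 ltW.
have g1 K : 1 <= gauge eps K by exact: gauge_ge1.
have PF' K : fine (P (F' K)) <= D / f * (gauge eps K)^-1.
  have g0 : 0 < gauge eps K by exact: lt_le_trans (g1 K).
  rewrite /F'; case: ifP => K0K; last first.
    by rewrite measure0 /= !mulr_ge0 ?invr_ge0 // ltW.
  have [_ PFK _] := hF K; apply: le_trans PFK _.
  set lam := _ * pair_prob _ _ _ _.
  have lam_ge : f * gauge eps K <= lam.
    have := l_hi K K0K; rewrite -ler_pdivlMl ?exprn_gt0 // => hg.
    rewrite /lam /pair_prob -/f [leRHS]mulrCA ler_pM2l //; apply: le_trans hg _.
    by rewrite natrX -exprD addnn -mul2n exprVn mulrC.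
  have lam0 : 0 < lam by apply: lt_le_trans lam_ge; exact: mulr_gt0.
  have lamV : lam^-1 <= f^-1 * (gauge eps K)^-1.
    by rewrite -invfM lef_pV2 ?posrE // mulr_gt0.
  apply: le_trans (hD _ _ _) _; first by rewrite invr_ge0 ltW.
    apply: le_trans lamV _; rewrite -[leRHS]mulr1 ler_pM2l ?invr_gt0 //.
    by rewrite invf_le1.
  by rewrite -mulrA ler_wpM2l.
have [C _ hC] := gauge_summable eps0.
have sumF n : \sum_(0 <= K < n) fine (P (F' K)) <= D / f * C.
  apply: (@le_trans _ _ (D / f * \sum_(0 <= K < n) (gauge eps K)^-1)).
    by rewrite mulr_sumr; apply: ler_sum => K _.
  by rewrite ler_wpM2l // mulr_ge0 // invr_ge0 ltW.
have := borel_cantelli mF' sumF; apply: filterS => w [k0 hk0].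
exists (b ^ ((maxn k0 K0).+2 * d + t))%N => n hn.
have [K [hK nlo nhi]] := ex_scale hn.
have [k0K K0K] : (k0 <= K)%N /\ (K0 <= K)%N by move: hK; rewrite geq_max => /andP.
have := hk0 K k0K; rewrite /F' K0K; have [_ _ /(_ w) h] := hF K.
move=> /h[X [Y [XN YN XY close]]].
apply: le_trans (mesh_ratio_ge_close_pair nlo nhi XN YN XY close).
by rewrite lee_fin; exact: hc nlo nhi (l_lo K).
Qed.

End Asymptotics.

Lemma not_quasi_uniform_of_cvg (R : realType) (d : nat) (x : nat -> 'rV[R]_d) :
  mesh_ratio (initial_segment x n) @[n --> \oo] --> +oo%E -> ~ quasi_uniform x.
Proof.
move=> /cvgeyPge div; rewrite /quasi_uniform; set S := [set _ | _ in _].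
move=> fin; have [A SA] : exists A : R, (ereal_sup S <= A%:E)%E.
  case: (ereal_sup S) fin => [r _|//|_]; first by exists r.
  by exists 0; rewrite leNye.
have [N _ hN] := div (A + 1).
have := hN (N + 2)%N (leq_addr _ _) => /= lo.
have : (mesh_ratio (initial_segment x (N + 2)) <= ereal_sup S)%E.
  by apply: ereal_sup_ubound; exists (N + 2)%N => //=; rewrite leq_addl.
move=> /(le_trans lo) /le_trans /(_ SA); rewrite lee_fin; lra.
Qed.

Unset Implicit Arguments.

Theorem corollary4p5 (R : realType) (b d t : nat)
    (hb : (2 <= b)%N) (hd : (1 <= d)%N) :
  (forall eps : R, 0 < eps ->
     exists2 c : R, 0 < c &
       forall (disp : measure_display) (Omega : measurableType disp)
         (P : probability Omega R)
         (x : nat -> 'rV[R]_d) (a : nat -> 'I_d -> nat -> 'I_b)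
         (pi : 'I_d * seq 'I_b -> Omega -> {perm 'I_b}),
         is_td_sequence b t x ->
         scrambling_digits x a ->
         owen_permutations P pi ->
         {ae P, forall w, exists n0 : nat, forall n : nat, (n0 <= n)%N ->
            ((c * n%:R `^ (1 / (2 * d%:R)) * ln n%:R `^ (- (1 / 2))
                * ln (2 + ln n%:R) `^ (- ((1 + eps) / 2)))%:E
             <= mesh_ratio (initial_segment (owen_scramble R pi a w) n))%E})
  /\
  (forall (disp : measure_display) (Omega : measurableType disp)
     (P : probability Omega R)
     (x : nat -> 'rV[R]_d) (a : nat -> 'I_d -> nat -> 'I_b)
     (pi : 'I_d * seq 'I_b -> Omega -> {perm 'I_b}),
     is_td_sequence b t x ->
     scrambling_digits x a ->
     owen_permutations P pi ->
     {ae P, forall w,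
        mesh_ratio (initial_segment (owen_scramble R pi a w) n)
          @[n --> \oo] --> +oo%E} /\
     {ae P, forall w, ~ quasi_uniform (owen_scramble R pi a w)}).
Proof.
split=> [eps eps0|disp Omega P x a pi tdx [xa _] Ppi].
  have [c c0 hc] := mesh_ratio_rate t hb hd eps0; exists c => //.
  move=> disp Omega P x a pi tdx [xa _] Ppi.
  have := hc _ _ _ _ _ _ tdx xa Ppi; apply: filterS => w [n0 hn0].
  by exists n0 => n /hn0; rewrite /rate !mulrA.
have [c c0 hc] := mesh_ratio_rate t hb hd (ltr01 : 0 < 1 :> R).
have div : {ae P, forall w,
    mesh_ratio (initial_segment (owen_scramble R pi a w) n)
      @[n --> \oo] --> +oo%E}.
  have := hc _ _ _ _ _ _ tdx xa Ppi; apply: filterS => w [n0 hn0].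
  apply/cvgeyPge => A; have [n1 hn1] := rate_unbounded A hd c0.
  exists (maxn n0 n1) => // n /=; rewrite geq_max => /andP[n0n n1n].
  by apply: le_trans (hn0 n n0n); rewrite lee_fin hn1.
split=> //; move: div; apply: filterS => w; exact: not_quasi_uniform_of_cvg.
Qed.
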